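(* Let $(Z_m)_{m\ge0}$ be the spider walk, and regard $Z_n$ as a complex-valued function on $\{-1,+1\}^n$. Then the sequence $\big(Z_n/\sqrt n\big)_{n=1}^\infty$ is not cosy.
   Context: Spider walk. Let $\omega=e^{2\pi i/3}$ and $v_0=0$, $v_1=-1$, $v_2=\omega^2$, which are the vertices of an equilateral triangle with side $1$ satisfying $v_{j+1}=v_j-\omega^j$ for $j\in\{0,1,2\}$ (index $j+1$ taken mod $3$). The state space is the set of points $v_j+k\omega^j$ with $j\in\{0,1,2\}$ and $k\in\{0,1,2,\dots\}$ (these points are distinct): three rays attached to the central triangle, each ray prolonging one side of the triangle. For a state $z=v_j+k\omega^j$ put $e(z)=\omega^j$; from $z$ the walk moves to $z+e(z)$ or $z-e(z)$ with probability $1/2$ each (both are again states; from $v_j$ the move $-\omega^j$ leads to $v_{j+1}$). The walk starts at the origin: $Z_0=0$. The set of $n$-step trajectories is the set of leaves of an $n$-level binary tree and is identified with $\{-1,+1\}^n$ (with uniform measure) via $Z_m=Z_{m-1}+\tau_m e(Z_{m-1})$ for $m=1,\dots,n$; thus $Z_n=Z_n(\tau_1,\dots,\tau_n)$ is a function $\{-1,+1\}^n\to\mathbb{C}$, $(Z_m)$ is a complex-valued martingale with steps of length $1$, and $\mathbb{E}|Z_n|^2=n$. Admissible measures and $\rho_{\max}$. Consider probability measures $\mu$ on $\{-1,+1\}^n\times\{-1,+1\}^n$ such that, for $(\tau',\tau'')\sim\mu$ and every $m=1,\dots,n$, $$\mathbb{E}\big(\tau'_m\,\big|\,\tau'_1,\tau''_1,\dots,\tau'_{m-1},\tau''_{m-1}\big)=\mathbb{E}\big(\tau''_m\,\big|\,\tau'_1,\tau''_1,\dots,\tau'_{m-1},\tau''_{m-1}\big)=0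 .$$ For such $\mu$ define $$\rho_{\max}(\mu)=\max_{m=1,\dots,n}\ \max\big|\mathbb{E}\big(\tau'_m\tau''_m\,\big|\,\tau'_1,\tau''_1,\dots,\tau'_{m-1},\tau''_{m-1}\big)\big|,$$ where the inner maximum is over all possible values (those of positive probability) of $(\tau'_1,\tau''_1,\dots,\tau'_{m-1},\tau''_{m-1})$; $\rho_{\max}$ is defined only for such measures. For $f,g:\{-1,+1\}^n\to\mathbb{C}$ write $\langle f|\mu|g\rangle=\mathbb{E}\,\overline{f(\tau')}\,g(\tau'')$ with $(\tau',\tau'')\sim\mu$, and $\|f\|^2=2^{-n}\sum_{\tau\in\{-1,+1\}^n}|f(\tau)|^2$. Cosiness. A sequence $(f_n)_{n=1}^\infty$ of functions $f_n:\{-1,+1\}^n\to\mathbb{C}$ with $0<\liminf_n\|f_n\|\le\limsup_n\|f_n\|<\infty$ is cosy if for every $\varepsilon>0$ there is a sequence $(\mu_n)_{n=1}^\infty$, where $\mu_n$ is a probability measure on $\{-1,+1\}^n\times\{-1,+1\}^n$ satisfying the conditional-mean-zero condition above, such that $\limsup_{n\to\infty}\rho_{\max}(\mu_n)<1$ and $\limsup_{n\to\infty}\big(\|f_n\|^2-\langle f_n|\mu_n|f_n\rangle\big)<\varepsilon$. *)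

(* Defs.v *)
From HB Require Import structures.
From mathcomp Require Import all_boot all_order all_algebra.
From mathcomp Require Import ring lra.
From mathcomp Require Import all_classical all_reals all_analysis.
From mathcomp Require Import complex.

Set Implicit Arguments.
Unset Strict Implicit.
Unset Printing Implicit Defensive.

Import Order.TTheory GRing.Theory Num.Theory.
Import numFieldNormedType.Exports.

Local Open Scope classical_set_scope.
Local Open Scope ring_scope.
Local Open Scope complex_scope.

(* {-1,+1}^n is encoded by n-tuples of booleans through [sgn]. The coordinates
   tau_1, ..., tau_n are [tnth tau i] for i : 'I_n, so i stands for m = i + 1. *)
Definition cube (n : nat) := n.-tuple bool.

Definition sgn (R : nzRingType) (b : bool) : R := if b then 1 else -1.

Section Coupling.
Context {R : realType} {n : nat}.
Implicit Types (mu : cube n * cube n -> R) (A : pred (cube n * cube n)).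

Definition is_prob mu : Prop := (forall w, 0 <= mu w) /\ \sum_w mu w = 1.

Definition prob mu A : R := \sum_(w | A w) mu w.

(* Meaningful only when [0 < prob mu A]. *)
Definition cond_expect mu A (X : cube n * cube n -> R) : R :=
  (\sum_(w | A w) mu w * X w) / prob mu A.

(* The event that (tau'_j, tau''_j), j < i (0-based), take the values they have
   at [w0]; with [w0] ranging over all pairs these are the atoms of the
   sigma-field generated by the past. *)
Definition past (i : nat) (w0 : cube n * cube n) : pred (cube n * cube n) :=
  fun w => (take i w.1 == take i w0.1) && (take i w.2 == take i w0.2).

Definition admissible mu : Prop :=
  is_prob mu /\
  forall (i : 'I_n) (w0 : cube n * cube n), 0 < prob mu (past i w0) ->
    cond_expect mu (past i w0) (fun w => sgn R (tnth w.1 i)) = 0 /\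
    cond_expect mu (past i w0) (fun w => sgn R (tnth w.2 i)) = 0.

(* Starting the maxima at 0 is harmless: the quantities are nonnegative. *)
Definition rho_max mu : R :=
  \big[Num.max/0]_(i < n)
    \big[Num.max/0]_(w0 | 0 < prob mu (past i w0))
      `|cond_expect mu (past i w0)
          (fun w => sgn R (tnth w.1 i) * sgn R (tnth w.2 i))|.

Definition coupled_form (f : cube n -> R[i]) mu (g : cube n -> R[i]) : R[i] :=
  \sum_w (mu w)%:C * (conjc (f w.1) * g w.2).

Definition l2norm (f : cube n -> R[i]) : R :=
  Num.sqrt ((2 ^+ n)^-1 * \sum_tau Normc.normc (f tau) ^+ 2).

End Coupling.

(* The term at n = 0 is unconstrained and irrelevant (only limits matter). *)
Record l2seq (R : realType) := L2Seq {
  l2seq_fun :> forall n, cube n -> R[i];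
  l2seq_liminf : (0 < limn_einf (fun n => (l2norm (@l2seq_fun n))%:E))%E;
  l2seq_limsup : (limn_esup (fun n => (l2norm (@l2seq_fun n))%:E) < +oo)%E }.
Arguments l2seq_fun {R} _ n _.

(* <f|mu|f> need not be real, so the inequality is read for real parts, as in
   E |f(tau') - f(tau'')|^2 / 2 = |f|^2 - Re <f|mu|f>. *)
Definition cosy (R : realType) (f : l2seq R) : Prop :=
  forall eps : R, 0 < eps ->
  exists mu : forall n, cube n * cube n -> R,
    [/\ forall n, (0 < n)%N -> admissible (mu n),
        (limn_esup (fun n => (rho_max (mu n))%:E) < 1)%E
      & (limn_esup (fun n => (l2norm (f n) ^+ 2
           - complex.Re (coupled_form (f n) (mu n) (f n)))%:E) < eps%:E)%E].

Section Spider.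
Context {R : realType}.

(* exp (2 pi i / 3) *)
Definition omega : R[i] := cos (2 * pi / 3) +i* sin (2 * pi / 3).

Definition spider_vertex (j : 'I_3) : R[i] := [:: 0; -1; omega ^+ 2]`_j.

Definition spider_point (j : 'I_3) (k : nat) : R[i] :=
  spider_vertex j + k%:R * omega ^+ j.

(* The direction e(z) of a state z; [spider_dirE] below shows that it is
   determined by z. Off the state space the value is the junk value 0. *)
Definition spider_dir (z : R[i]) : R[i] :=
  xget 0 [set d | exists (j : 'I_3) (k : nat),
                    z = spider_point j k /\ d = omega ^+ j].

Definition spider_step (z : R[i]) (b : bool) : R[i] :=
  z + sgn R[i] b * spider_dir z.

Definition spider (n : nat) (tau : cube n) : R[i] := foldl spider_step 0 tau.

Definition spider_scaled (n : nat) (tau : cube n) : R[i] :=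
  spider tau / (Num.sqrt n%:R)%:C.

Lemma cos_2pi3 : cos (2 * pi / 3) = - 2^-1 :> R.
Proof.
have c0 : 0 < cos (pi / 3) :> R.
  apply: cos_gt0_pihalf; have := pi_gt0 R; lra.
have e1 : cos (2 * pi / 3) = - cos (pi / 3) :> R.
  by rewrite -(cosN (pi / 3)) -cosDpi; congr cos; field.
have e2 : cos (2 * pi / 3) = cos (pi / 3) ^+ 2 *+ 2 - 1 :> R.
  by rewrite -cos_mulr2n; congr cos; rewrite mulr2n; field.
nra.
Qed.

Lemma sin_2pi3 : 0 < sin (2 * pi / 3) :> R.
Proof. by apply: sin_gt0_pi; have := pi_gt0 R; lra. Qed.

Lemma sin2_2pi3 : sin (2 * pi / 3) ^+ 2 = 3 / 4 :> R.
Proof. by rewrite sin2cos2 cos_2pi3; field. Qed.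

Lemma omega2E : omega ^+ 2 = (- 2^-1) +i* (- sin (2 * pi / 3)).
Proof.
rewrite expr2 /omega cos_2pi3; have := sin2_2pi3; set s := sin _ => s2.
by apply/eqP; rewrite eq_complex /=; apply/andP; split; apply/eqP; nra.
Qed.

Lemma sum_omega : 1 + omega + omega ^+ 2 = 0.
Proof.
rewrite omega2E /omega cos_2pi3.
by apply/eqP; rewrite eq_complex /=; apply/andP; split; apply/eqP; field.
Qed.

Lemma omega3 : omega ^+ 3 = 1.
Proof.
apply/eqP; rewrite -subr_eq0; apply/eqP.
by rewrite -[RHS](mulr0 (omega - 1)) -sum_omega; ring.
Qed.

Lemma ord3_ind (P : 'I_3 -> Prop) : P 0 -> P 1 -> P 2 -> forall j, P j.
Proof.
move=> p0 p1 p2 [[|[|[|//]]] h].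
- by rewrite (_ : Ordinal h = 0) //; apply/val_inj.
- by rewrite (_ : Ordinal h = 1) //; apply/val_inj.
- by rewrite (_ : Ordinal h = 2) //; apply/val_inj.
Qed.

Lemma spider_vertexS (j : 'I_3) :
  spider_vertex (j + 1) = spider_vertex j - omega ^+ j.
Proof.
have := sum_omega; have := omega3.
elim/ord3_ind: j => w3 w0; rewrite /spider_vertex /=.
- by rewrite expr0 sub0r.
- by rewrite expr1 -[LHS]subr0 -w0; ring.
- by rewrite subrr.
Qed.

Lemma spider_pointE (j : 'I_3) (k : nat) :
  spider_point j k =
    let s := sin (2 * pi / 3) in
    if j == 0 then k%:R +i* 0
    else if j == 1 then (- 1 - k%:R / 2) +i* (k%:R * s)
    else (- (1 + k%:R) / 2) +i* (- (1 + k%:R) * s).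
Proof.
have kE : k%:R = k%:R%:C :> R[i] by rewrite rmorph_nat.
rewrite /spider_point /spider_vertex kE; elim/ord3_ind: j => /=.
- by rewrite expr0 mulr1 add0r.
- rewrite expr1 /omega cos_2pi3.
  by apply/eqP; rewrite eq_complex /=; apply/andP; split; apply/eqP; field.
- rewrite omega2E.
  by apply/eqP; rewrite eq_complex /=; apply/andP; split; apply/eqP; field.
Qed.

Lemma spider_point_inj (j j' : 'I_3) (k k' : nat) :
  spider_point j k = spider_point j' k' -> j = j' /\ k = k'.
Proof.
have k0 : 0 <= k%:R :> R by [].
have k0' : 0 <= k'%:R :> R by [].
have s0 := sin_2pi3.
have E : k%:R = k'%:R :> R -> k = k' by move/eqP; rewrite eqr_nat => /eqP.
rewrite !spider_pointE; elim/ord3_ind: j; elim/ord3_ind: j' => /= h;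
  have /= h1 := congr1 (@complex.Re R) h; have /= h2 := congr1 (@complex.Im R) h;
  first [by split; [|apply: E; lra] | by exfalso; nra].
Qed.

Lemma spider_dirE (j : 'I_3) (k : nat) :
  spider_dir (spider_point j k) = omega ^+ j.
Proof.
apply: xget_unique; first by exists j, k.
by move=> _ [j' [k' [/spider_point_inj[<- _] ->]]].
Qed.

Lemma spider_step_up (j : 'I_3) (k : nat) :
  spider_step (spider_point j k) true = spider_point j k.+1.
Proof.
by rewrite /spider_step spider_dirE /sgn /spider_point -natr1; ring.
Qed.

Lemma spider_step_down (j : 'I_3) (k : nat) :
  spider_step (spider_point j k) false =
    if k is k'.+1 then spider_point j k' else spider_point (j + 1) 0.
Proof.
rewrite /spider_step spider_dirE /sgn /spider_point; case: k => [|k].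
  by rewrite spider_vertexS; ring.
by rewrite -natr1; ring.
Qed.

Let sqn (z : R[i]) : R := Normc.normc z ^+ 2.

Let sqnE z : sqn z = complex.Re z ^+ 2 + complex.Im z ^+ 2.
Proof. by case: z => a b; rewrite /sqn /= sqr_sqrtr ?addr_ge0 ?sqr_ge0. Qed.

Let sqn_omega (j : 'I_3) : sqn (omega ^+ j) = 1.
Proof.
rewrite sqnE; have := sin2_2pi3; elim/ord3_ind: j => h.
- by rewrite /=; ring.
- by rewrite /= h cos_2pi3; field.
- by rewrite [omega ^+ _]omega2E /= !sqrrN h; field.
Qed.

Lemma spider_sqnorm n (j : 'I_3) (k : nat) :
  \sum_(t : n.-tuple bool)
     Normc.normc (foldl spider_step (spider_point j k) t) ^+ 2 =
  2 ^+ n * (Normc.normc (spider_point j k) ^+ 2 + n%:R) :> R.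
Proof.
have step (i : 'I_3) (l : nat) b : exists (i' : 'I_3) (l' : nat),
    spider_step (spider_point i l) b = spider_point i' l'.
  case: b; first by exists i, l.+1; rewrite spider_step_up.
  rewrite spider_step_down; case: l => [|l]; [by exists (i + 1), 0 | by exists i, l].
elim: n j k => [|n IHn] j k.
  rewrite (big_pred1 [tuple]) => [|t]; last first.
    by apply/esym/eqP; rewrite [LHS]tuple0.
  by rewrite /= expr0 mul1r addr0.
rewrite (reindex (fun p : bool * n.-tuple bool => [tuple of p.1 :: p.2])) /=;
  last first.
  exists (fun t => (thead t, [tuple of behead t])) => [[x t] _|t _].
    by congr (_, _); apply/val_inj.
  by rewrite [RHS]tuple_eta; apply/val_inj.
rewrite -(pair_bigA _ (fun b (t : n.-tuple bool) =>
  Normc.normc (foldl spider_step (spider_step (spider_point j k) b) t) ^+ 2)) /=.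
rewrite big_bool /=.
have [j1 [k1 e1]] := step j k true; have [j2 [k2 e2]] := step j k false.
rewrite e1 e2 !IHn -e1 -e2.
have h : sqn (spider_step (spider_point j k) true)
       + sqn (spider_step (spider_point j k) false)
       = 2 * (sqn (spider_point j k) + 1).
  rewrite /spider_step spider_dirE /sgn; have := sqn_omega j; rewrite !sqnE.
  by case: (omega ^+ j) => a b; case: (spider_point j k) => c d /=; nra.
rewrite [2 ^+ n.+1]exprSr -mulrA -mulrDr -natr1; congr (_ * _).
by move: h; rewrite /sqn; lra.
Qed.

Lemma l2norm_spider_scaled n : (0 < n)%N -> l2norm (@spider_scaled n) = 1.
Proof.
move=> n0; rewrite /l2norm /spider_scaled.
have n0' : n%:R != 0 :> R by rewrite pnatr_eq0 -lt0n.
have e0 : 0 = spider_point 0 0 by rewrite /spider_point mul0r addr0.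
have nE : Normc.normc (Num.sqrt n%:R)%:C ^+ 2 = n%:R :> R.
  by rewrite -/(sqn _) sqnE /= expr0n addr0 sqr_sqrtr.
under eq_bigr => t _ do rewrite Normc.normcM Normc.normcV exprMn exprVn nE.
rewrite /= -mulr_suml /spider e0 spider_sqnorm -e0.
rewrite Normc.normc0 expr0n add0r mulfK//.
by rewrite mulVf ?sqrtr1// expf_neq0// pnatr_eq0.
Qed.

End Spider.

Lemma cvg_l2norm_spider_scaled (R : realType) :
  (l2norm (@spider_scaled R n))%:E @[n --> \oo] --> 1%E.
Proof.
apply: cvg_near_cst; near=> n; congr (_%:E); apply: l2norm_spider_scaled.
by near: n; exact: nbhs_infty_gt.
Unshelve. all: by end_near. Qed.

Lemma spider_scaled_liminf (R : realType) :
  (0 < limn_einf (fun n => (l2norm (@spider_scaled R n))%:E))%E.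
Proof. by rewrite (cvg_limn_einf_sup (@cvg_l2norm_spider_scaled R)).1 lte01. Qed.

Lemma spider_scaled_limsup (R : realType) :
  (limn_esup (fun n => (l2norm (@spider_scaled R n))%:E) < +oo)%E.
Proof. by rewrite (cvg_limn_einf_sup (@cvg_l2norm_spider_scaled R)).2 ltry. Qed.

Definition spider_seq (R : realType) : l2seq R :=
  L2Seq (@spider_scaled_liminf R) (@spider_scaled_limsup R).

(* Main.v *)
Require Import Defs.
From mathcomp Require Import all_boot all_order all_algebra.
From mathcomp Require Import ring lra.
From mathcomp Require Import all_classical all_reals all_analysis.
From mathcomp Require Import complex.

Set Implicit Arguments.
Unset Strict Implicit.
Unset Printing Implicit Defensive.

Import Order.TTheory GRing.Theory Num.Theory.

Local Open Scope classical_set_scope.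
Local Open Scope ring_scope.
Local Open Scope complex_scope.

(** Two spider walks Z' and Z'' driven by coupled signs of conditional
    correlation at most rho < 1 in absolute value are shown to drift apart at
    the scale of sqrt n, at a rate that does not depend on rho.

    Let d be the distance along the tripod between the two walkers. Away from
    the centre d is a submartingale, because each walker has mean zero
    increments and d is convex along a common ray. When Z' is at the centre
    while Z'' is far out on some ray, the next excursion of Z' takes place on
    another ray with asymptotic probability 2/3, which increases d, and on the
    ray of Z'' with probability 1/3, which decreases it; so d grows by a third
    of the local time of Z' at the centre. A bounded correction [bonus] spreads
    this gain evenly over the three vertices of the central triangle. Thus
    E d_n is at least a fixed multiple of the total time spent at the centre by
    the two walkers, which is of order sqrt n ([expect_radius_ge]), except for a
    loss caused by the times when both walkers are at the centre simultaneously
    ([potential_drift]).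

    The loss is o(sqrt n), and this is the only place where rho < 1 enters. If x
    is the sum of the squared distances of the two walkers from the centre, then
    a power of x with exponent below but close to 1/2 is still a submartingale:
    the increment of x has conditional second moment at most 4 (1 + rho) x, less
    than the 8 x that would be needed to destroy the drift of the square root
    ([slow_fun_drift]). Such a power has a fixed gain each
    time both walkers are central, while its expectation is o(sqrt n)
    ([slow_submartingale]).

    Hence E d_n >= c sqrt n - C(rho) with an absolute c > 0
    ([expect_tree_dist_ge]). As |Z' - Z''|^2 >= (3/4) d^2, and as
    ||f||^2 - Re <f|mu|f> is half of E |f(tau') - f(tau'')|^2, for n large this
    gap stays above an absolute constant ([gap_unif]), which contradicts
    cosiness for small epsilon. *)

(** * Drift of functions of two coupled walkers *)

(** The point v_j + k omega^j is encoded by the pair (j, k). *)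
Definition state := ('I_3 * nat)%type.

Definition step (S : state) (b : bool) : state :=
  if b then (S.1, S.2.+1)
  else if S.2 is k.+1 then (S.1, k) else (S.1 + 1, 0%N).

Definition walk (s : seq bool) : state := foldl step (0, 0%N) s.

Section PairMean.
Context {R : realType}.
Implicit Types (V : state -> state -> R) (S T : state) (r : R).

(** The expectation of [V] after one step from (S, T), for two unbiased signs
    of correlation r: the joint law of such signs is determined by r. *)
Definition pair_mean r V S T : R :=
  ((1 + r) * (V (step S true) (step T true) + V (step S false) (step T false))
   + (1 - r) *
     (V (step S true) (step T false) + V (step S false) (step T true)))
  / 4.

(** [pair_mean] is affine in r, so that a lower bound for all correlations
    reduces to r = 1 (equal signs) and r = -1 (opposite signs). *)
Lemma pair_mean_ge r V S T (A : R) : `|r| <= 1 ->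
    A *+ 2 <= V (step S true) (step T true) + V (step S false) (step T false) ->
    A *+ 2 <= V (step S true) (step T false) + V (step S false) (step T true) ->
  A <= pair_mean r V S T.
Proof.
rewrite /pair_mean ler_norml => /andP[r1 r2].
set a := V _ _ + V _ _; set b := V _ _ + V _ _; rewrite mulr2n => ha hb.
have : (1 + r) * (A + A) <= (1 + r) * a by apply: ler_wpM2l => //; lra.
have : (1 - r) * (A + A) <= (1 - r) * b by apply: ler_wpM2l => //; lra.
lra.
Qed.

(** The walk turns around the central triangle in one direction only; giving
    all pairs of rays the same additive constant 1 makes the distance symmetric
    in the two walkers. *)
Definition tree_dist S T : R :=
  if S.1 == T.1 then `|S.2%:R - T.2%:R| else S.2%:R + T.2%:R + 1.

(** With the second walker far out on ray j', the distance alone has drift 0,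
    1/2, 0 when the first walker is at the vertex with j - j' = 0, 1, 2: only
    one vertex is productive. Since each vertex is left for the next one with
    probability 1/2, a bonus p_i held at vertex i changes its drift by
    p_(i+1) / 2 - p_i, and the values 1/7, 3/7, 0 equalize the drifts to 1/14
    at all three vertices. *)
Definition bonus S T : R :=
  if S.2 is 0%N then [:: 1 / 7; 3 / 7; 0]`_(S.1 - T.1 : 'I_3)%R else 0.

(** The drift of k is 1/2 at k = 0 and 0 elsewhere, so subtracting
    (k + l) / 7 removes exactly the drift 1/14 gained at each central visit. *)
Definition potential S T : R :=
  tree_dist S T + bonus S T + bonus T S - (S.2%:R + T.2%:R) / 7.

Definition both_central S T : R := ((S.2 == 0) && (T.2 == 0))%:R.

Lemma bonus_ge0 S T : 0 <= bonus S T.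
Proof.
case: S T => [j [|k]] [j' l] //; rewrite /bonus /=.
by elim/ord3_ind: j; elim/ord3_ind: j' => /=; lra.
Qed.

Lemma pair_mean_sym r V S T : (forall S' T', V S' T' = V T' S') ->
  pair_mean r V S T = pair_mean r V T S.
Proof.
move=> VC; rewrite /pair_mean [V (step S _) _]VC (VC (step S false)).
rewrite [V (step S true) (step T false)]VC (VC (step S false)).
by rewrite [X in _ + _ * X]addrC.
Qed.

Lemma potentialC S T : potential S T = potential T S.
Proof.
rewrite /potential /tree_dist eq_sym distrC.
by case: eqP => _; ring.
Qed.

Lemma potential_drift_off_centre r S T : `|r| <= 1 -> T.2 != 0%N ->
  potential S T <= pair_mean r potential S T.
Proof.
case: S T => [j k] [j' [//|l]] r1 _.
have b := bonus_ge0; have l0 := ler0n R l; have k0 := ler0n R k.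
have l1 := @natr1 R l; have l2 := @natr1 R l.+1.
apply: pair_mean_ge => //; case: k k0 => [|k] k0.
(* In each case the bonus of a walker that may arrive at the centre is only
   known to be nonnegative, which suffices. *)
- have b1 := b (j', l.+2) (j, 1%N); have b2 := b (j', l) (j + 1, 0%N).
  rewrite /potential /step /=.
  move: (bonus (j', l.+2) _) (bonus (j', l) _) b1 b2 => x y x0 y0.
  rewrite /bonus /tree_dist /= -l2 -l1.
  elim/ord3_ind: j; elim/ord3_ind: j' => /=;
    do ?[rewrite ler0_norm; last lra]; lra.
- have b1 := b (j, k.+2) (j', l.+2); have b2 := b (j', l.+2) (j, k.+2).
  have b3 := b (j, k) (j', l); have b4 := b (j', l) (j, k).
  have k1 := @natr1 R k; have k2 := @natr1 R k.+1.
  rewrite /potential /step /=.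
  move: (bonus _ (j', l.+2)) (bonus _ (j, k.+2)) b1 b2 => x y x0 y0.
  move: (bonus _ (j', l)) (bonus _ (j, k)) b3 b4 => z t z0 t0.
  rewrite /bonus /tree_dist /= -l2 -l1 -k2 -k1; case: eqP => _; last lra.
  have e2 : k%:R + 1 + 1 - (l%:R + 1 + 1) = k%:R - l%:R :> R by ring.
  have e1 : k%:R + 1 - (l%:R + 1) = k%:R - l%:R :> R by ring.
  rewrite e2 e1; lra.
- have b1 := b (j', l) (j, 1%N); have b2 := b (j', l.+2) (j + 1, 0%N).
  rewrite /potential /step /=.
  move: (bonus (j', l) _) (bonus (j', l.+2) _) b1 b2 => x y x0 y0.
  rewrite /bonus /tree_dist /= -l2 -l1.
  have d1 := ler_norm (l%:R - 1 : R).
  elim/ord3_ind: j; elim/ord3_ind: j' => /=;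
    rewrite ?[`|1 - _|]distrC; do ?[rewrite ler0_norm; last lra]; lra.
- have b1 := b (j, k.+2) (j', l); have b2 := b (j', l) (j, k.+2).
  have b3 := b (j, k) (j', l.+2); have b4 := b (j', l.+2) (j, k).
  have k1 := @natr1 R k; have k2 := @natr1 R k.+1.
  rewrite /potential /step /=.
  move: (bonus _ (j', l)) (bonus _ (j, k.+2)) b1 b2 => x y x0 y0.
  move: (bonus _ (j', l.+2)) (bonus _ (j, k)) b3 b4 => z t z0 t0.
  rewrite /bonus /tree_dist /= -l2 -l1 -k2 -k1; case: eqP => _; last lra.
  (* Opposite signs move the difference k - l by 2 either way: convexity. *)
  have d := ler_normD (k%:R + 1 + 1 - l%:R) (k%:R - (l%:R + 1 + 1) : R).
  have e : k%:R + 1 + 1 - l%:R + (k%:R - (l%:R + 1 + 1))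
     = (k%:R + 1 - (l%:R + 1)) *+ 2 :> R by ring.
  rewrite e normrMn in d; lra.
Qed.

(** When both walkers are central the potential may drop, but by a bounded
    amount. *)
Lemma potential_drift r S T : `|r| <= 1 ->
  potential S T - 3 * both_central S T <= pair_mean r potential S T.
Proof.
move=> r1; rewrite /both_central.
have [T0|T0] := eqVneq T.2 0%N; last first.
  by rewrite andbF mulr0 subr0 potential_drift_off_centre.
have [S0|S0] := eqVneq S.2 0%N; last first.
  rewrite /= mulr0 subr0 potentialC (pair_mean_sym _ _ _ potentialC).
  exact: potential_drift_off_centre.
move: S T S0 T0 => [j k] [j' l] /= -> ->.
apply: pair_mean_ge => //; rewrite /potential /step /bonus /tree_dist /=;
  elim/ord3_ind: j; elim/ord3_ind: j' => /=;
  rewrite ?subrr ?subr0 ?sub0r ?normrN ?normr0 ?normr1; lra.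
Qed.
End PairMean.

(** * Expectations along a coupling *)

Section Coupled.
Context {R : realType} {n : nat}.
Implicit Types (mu : cube n * cube n -> R) (w : cube n * cube n).

Definition expect mu (X : cube n * cube n -> R) : R := \sum_w mu w * X w.

Lemma expect_le mu X Y : is_prob mu -> (forall w, X w <= Y w) ->
  expect mu X <= expect mu Y.
Proof. by move=> [mu0 _] XY; apply: ler_sum => w _; apply: ler_wpM2l. Qed.

Lemma expectD mu X Y :
  expect mu (fun w => X w + Y w) = expect mu X + expect mu Y.
Proof.
by rewrite /expect -big_split; apply: eq_bigr => w _; rewrite mulrDr.
Qed.

Lemma expectZ mu c X : expect mu (fun w => c * X w) = c * expect mu X.
Proof. by rewrite /expect mulr_sumr; apply: eq_bigr => w _; rewrite mulrCA. Qed.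

Lemma expect_cst mu c : is_prob mu -> expect mu (fun=> c) = c.
Proof. by case=> _ mu1; rewrite /expect -mulr_suml mu1 mul1r. Qed.

(** On an atom of the past, the conditional law of the next pair of signs has
    unbiased marginals, hence is the one that [pair_mean] integrates against,
    r being the conditional correlation. *)
Lemma sum_past mu (i : 'I_n) w0 (Phi : bool -> bool -> R) :
  admissible mu -> 0 < prob mu (past i w0) ->
  let r := cond_expect mu (past i w0)
             (fun w => sgn R (tnth w.1 i) * sgn R (tnth w.2 i)) in
  \sum_(w | past i w0 w) mu w * Phi (tnth w.1 i) (tnth w.2 i) =
  prob mu (past i w0) *
    (((1 + r) * (Phi true true + Phi false false)
      + (1 - r) * (Phi true false + Phi false true)) / 4).
Proof.
move=> [_ adm] p0 r; have [e1 e2] := adm i w0 p0.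
have pn : prob mu (past i w0) != 0 by rewrite gt_eqF.
set P := prob mu (past i w0) in p0 pn r *.
have s1 : \sum_(w | past i w0 w) mu w * sgn R (tnth w.1 i) = 0.
  by move/(congr1 (fun x => x * P)): e1; rewrite /cond_expect mul0r divfK.
have s2 : \sum_(w | past i w0 w) mu w * sgn R (tnth w.2 i) = 0.
  by move/(congr1 (fun x => x * P)): e2; rewrite /cond_expect mul0r divfK.
have s3 : \sum_(w | past i w0 w)
    mu w * (sgn R (tnth w.1 i) * sgn R (tnth w.2 i)) = r * P.
  by rewrite /r /cond_expect divfK.
(* The Walsh expansion of Phi: only c0 and c3 survive the integration. *)
pose Ptt := Phi true true; pose Pff := Phi false false.
pose Ptf := Phi true false; pose Pft := Phi false true.
pose c0 := (Ptt + Pff + Ptf + Pft) / 4; pose c1 := (Ptt - Pff + Ptf - Pft) / 4.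
pose c2 := (Ptt - Pff - Ptf + Pft) / 4; pose c3 := (Ptt + Pff - Ptf - Pft) / 4.
have PhiE b c :
    Phi b c = c0 + c1 * sgn R b + c2 * sgn R c + c3 * (sgn R b * sgn R c).
  by rewrite /c0 /c1 /c2 /c3 /Ptt /Pff /Ptf /Pft /sgn; case: b; case: c; field.
transitivity (c0 * P + c1 * 0 + c2 * 0 + c3 * (r * P)); last first.
  by rewrite /c0 /c3 /Ptt /Pff /Ptf /Pft; field.
rewrite -[in c1 * _]s1 -[in c2 * _]s2 -s3 /P /prob !mulr_sumr -!big_split /=.
by apply: eq_bigr => w _; rewrite PhiE; ring.
Qed.

Lemma cond_expect_le_rho_max mu (i : 'I_n) w0 : 0 < prob mu (past i w0) ->
  `|cond_expect mu (past i w0)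
      (fun w => sgn R (tnth w.1 i) * sgn R (tnth w.2 i))| <= rho_max mu.
Proof.
move=> p0; rewrite /rho_max (bigD1 i) //= le_max; apply/orP; left.
by rewrite (bigD1 w0) //= le_max lexx.
Qed.

Lemma walk_take (i : 'I_n) (t : cube n) :
  walk (take i.+1 t) = step (walk (take i t)) (tnth t i).
Proof.
rewrite (take_nth true) ?size_tuple ?ltn_ord // /walk foldl_rcons.
by rewrite (tnth_nth true).
Qed.

Lemma submartingale_step mu (rho : R) (i : 'I_n) (F G : state -> state -> R) :
    admissible mu -> rho_max mu <= rho ->
    (forall r S T, `|r| <= rho -> F S T <= pair_mean r G S T) ->
  expect mu (fun w => F (walk (take i w.1)) (walk (take i w.2))) <=
  expect mu (fun w => G (walk (take i.+1 w.1)) (walk (take i.+1 w.2))).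
Proof.
move=> adm rmu FG; have mu0 := adm.1.1.
pose past_of w := ([tuple of take i w.1], [tuple of take i w.2]).
rewrite /expect (partition_big past_of predT) //=.
rewrite [leRHS](partition_big past_of predT) //=.
apply: ler_sum => u _.
have [/existsP[w0 /eqP u0]|] := boolP [exists w0, past_of w0 == u]; last first.
  rewrite negb_exists => /forallP un.
  by rewrite !big_pred0 // => w; apply/negbTE.
have pE w : (past_of w == u) = past i w0 w.
  by rewrite -u0 /past_of /past xpair_eqE -!val_eqE.
rewrite !(eq_bigl _ _ pE).
have [p0|] := boolP (0 < prob mu (past i w0)); last first.
  rewrite -leNgt => p0.
  have z w : past i w0 w -> mu w = 0.
    have : prob mu (past i w0) == 0.
      by rewrite eq_le p0 sumr_ge0.
    rewrite psumr_eq0 // => /allP /(_ w).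
    by rewrite mem_index_enum => /(_ isT) /implyP h /h /eqP.
  by rewrite !big1 // => w /z ->; rewrite mul0r.
set S := walk (take i w0.1); set T := walk (take i w0.2).
have [eF eG] : (forall w, past i w0 w ->
      F (walk (take i w.1)) (walk (take i w.2)) = F S T) /\
    (forall w, past i w0 w ->
      G (walk (take i.+1 w.1)) (walk (take i.+1 w.2)) =
      G (step S (tnth w.1 i)) (step T (tnth w.2 i))).
  split=> w /andP[/eqP h1 /eqP h2]; first by rewrite h1 h2.
  by rewrite !walk_take h1 h2.
rewrite [leLHS](eq_bigr (fun w => mu w * F S T)) => [|w /eF -> //].
rewrite [leRHS](eq_bigr (fun w => mu w *
  G (step S (tnth w.1 i)) (step T (tnth w.2 i)))) => [|w /eG -> //].
rewrite -mulr_suml (sum_past (fun b c => G (step S b) (step T c)) adm p0).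
apply: ler_wpM2l; first exact: ltW.
by apply: FG; apply: le_trans rmu; apply: cond_expect_le_rho_max.
Qed.

(** The transfer principle: every estimate on the coupled walks below comes
    from a pointwise drift inequality for a suitable function of the time and
    the two states. *)
Lemma submartingale mu (rho : R) (F : nat -> state -> state -> R) :
    admissible mu -> rho_max mu <= rho ->
    (forall m r S T, `|r| <= rho -> F m S T <= pair_mean r (F m.+1) S T) ->
  F 0 (walk [::]) (walk [::]) <= expect mu (fun w => F n (walk w.1) (walk w.2)).
Proof.
move=> adm rmu FF.
suff h i : (i <= n)%N -> F 0 (walk [::]) (walk [::]) <=
    expect mu (fun w => F i (walk (take i w.1)) (walk (take i w.2))).
  apply: le_trans (h n (leqnn n)) _; apply: expect_le; first exact: adm.1.
  by move=> w; rewrite !take_oversize ?size_tuple.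
elim: i => [_|i IH lt_in].
  rewrite [leRHS](_ : _ = expect mu (fun=> F 0 (walk [::]) (walk [::]))).
    by rewrite expect_cst //; exact: adm.1.
  by apply: eq_bigr => w _; rewrite !take0.
apply: le_trans (IH (ltnW lt_in)) _.
exact: (submartingale_step (Ordinal lt_in) adm rmu (FF i)).
Qed.

End Coupled.

(** * A slowly growing submartingale *)

Section SlowFunction.
Context {R : realType}.
Implicit Types (S T : state) (r rho z t x : R).

(** 1/8 is the second order coefficient of the square root; the margin z pays
    for the higher orders on |t| <= z. *)
Lemma sqrt_ge_quadratic z t : 0 < z <= 80^-1 -> `|t| <= z ->
  1 + t / 2 - (8^-1 + z) * t ^+ 2 <= Num.sqrt (1 + t).
Proof.
move=> /andP[z0 z1]; rewrite ler_norml => /andP[t0 t1].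
set y := _ - _; apply: le_trans (ler_norm y) _; rewrite -sqrtr_sqr.
apply: ler_wsqrtr.
have -> : y ^+ 2 = 1 + t +
    t ^+ 2 * (- (2 * z) - (8^-1 + z) * t + (8^-1 + z) ^+ 2 * t ^+ 2).
  by rewrite /y; field.
rewrite gerDl; apply: mulr_ge0_le0; first exact: sqr_ge0.
have b1 : - ((8^-1 + z) * t) <= (8^-1 + z) * z.
  rewrite -mulrN; apply: ler_wpM2l; lra.
have b2 : (8^-1 + z) ^+ 2 * t ^+ 2 <= (8^-1 + z) ^+ 2 * z ^+ 2.
  by apply: ler_wpM2l; [exact: sqr_ge0|nra].
nra.
Qed.

Lemma powRN_ge_linear z t : 0 <= z -> -1 < t -> 1 - z * t <= (1 + t) `^ (- z).
Proof.
move=> z0 t1; rewrite /powR gt_eqF; last by lra.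
apply: le_trans (expR_ge1Dx _); rewrite mulNr lerD2l lerN2.
by apply: ler_wpM2l => //; apply: le_ln1Dx.
Qed.

(** Product of the two previous bounds: lowering the exponent from 1/2 to
    1/2 - z costs only O(z) in each coefficient. *)
Lemma powR_ge_quadratic z t : 0 < z <= 80^-1 -> `|t| <= z ->
  1 + (2^-1 - z) * t - (8^-1 + 2 * z) * t ^+ 2 <= (1 + t) `^ (2^-1 - z).
Proof.
move=> z01 tz; have s := sqrt_ge_quadratic z01 tz.
move: z01 (tz) => /andP[z0 z1]; rewrite ler_norml => /andP[t0 t1].
have t2 : -1 < t by lra.
have p := powRN_ge_linear (ltW z0) t2.
rewrite powRD ?powR12_sqrt; [|lra|by apply/implyP => _; rewrite gt_eqF; lra].
have l0 : 0 <= 1 - z * t by nra.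
apply: le_trans (ler_wpM2l (sqrtr_ge0 _) p).
apply: le_trans (ler_wpM2r l0 s).
rewrite -subr_ge0.
have -> : (1 + t / 2 - (8^-1 + z) * t ^+ 2) * (1 - z * t) -
   (1 + (2^-1 - z) * t - (8^-1 + 2 * z) * t ^+ 2) =
   t ^+ 2 * (z * (2^-1 + (8^-1 + z) * t)) by field.
apply: mulr_ge0; first exact: sqr_ge0.
apply: mulr_ge0; nra.
Qed.

(** Placing the vertex at 1/2 rather than 0 makes the step at the centre the
    reflection of 1/2 - 1 = -1/2, so that the squared radius moves by
    (a + tau)^2 at every state, central or not. *)
Definition radius S : R := S.2%:R + 2^-1.

Lemma radius_step S b :
  radius (step S b) ^+ 2 = radius S ^+ 2 + 2 * radius S * sgn R b + 1.
Proof.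
case: S => j k; rewrite /radius /step /sgn; case: b => /=.
  by rewrite -natr1; ring.
by case: k => [|k] /=; rewrite -?natr1; field.
Qed.

Definition shell K S T : R := K + radius S ^+ 2 + radius T ^+ 2.

Lemma shell_step K S T b c : shell K (step S b) (step T c) =
  shell K S T + 2 * radius S * sgn R b + 2 * radius T * sgn R c + 2.
Proof. by rewrite /shell !radius_step; ring. Qed.

Definition slack rho : R := (1 - rho) / 80.

(** Large enough for the relative increments of [shell] to be at most
    [slack rho] at every state. *)
Definition offset rho : R := (2 / slack rho + 2) / slack rho.

Definition slow_fun rho S T : R :=
  shell (offset rho) S T `^ (2^-1 - slack rho).

(** For x the shell, a step multiplies x by 1 + t with E t = 2 / x and
    E t^2 <= 4 (1 + rho) / x. Up to O(z), with z the slack, the relative drift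
    of x^(1/2 - z) is then at least (1/2) (2 / x) - (1/8) 4 (1 + rho) / x,
    that is (1 - rho) / (2 x); half of it absorbs the O(z). *)
Lemma slow_fun_drift rho r S T : 0 <= rho < 1 -> `|r| <= rho ->
  slow_fun rho S T * (1 + (1 - rho) / 4 / shell (offset rho) S T)
  <= pair_mean r (slow_fun rho) S T.
Proof.
move=> /andP[rho0 rho1] rr; rewrite /slow_fun /offset.
have zE : slack rho = (1 - rho) / 80 by [].
set z := slack rho in zE *; have z0 : 0 < z by lra.
have zz : 0 < z <= 80^-1 by rewrite z0; lra.
set K := _ / z; set al := 2^-1 - z.
have zi : 80 <= z^-1 by rewrite -[80]invrK lef_pV2 ?posrE ?invr_gt0 //; lra.
have zK : z * K = 2 / z + 2 by rewrite /K mulrC divfK // gt_eqF.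
have K1 : 4 <= K by rewrite /K; nra.
set a := radius S; set b := radius T; set x := shell K S T.
have a0 : 0 < a by rewrite /a /radius ltr_wpDl.
have b0 : 0 < b by rewrite /b /radius ltr_wpDl.
have x0 : 0 < x by rewrite /x /shell -/a -/b; nra.
pose h c d : R := 2 * a * sgn R c + 2 * b * sgn R d + 2.
have hx c d : `|h c d / x| <= z.
  rewrite normrM [`|x^-1|]gtr0_norm ?invr_gt0 // ler_pdivrMr //.
  (* AM-GM; this is where the value of the offset comes from. *)
  have bnd y : 2 * y <= z * y ^+ 2 + z^-1.
    rewrite -subr_ge0.
    have -> : z * y ^+ 2 + z^-1 - 2 * y = z^-1 * (z * y - 1) ^+ 2.
      by field; rewrite gt_eqF.
    by rewrite mulr_ge0 ?sqr_ge0 // invr_ge0 ltW.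
  have := bnd a; have := bnd b => ha hb.
  have -> : z * x = 2 / z + 2 + z * a ^+ 2 + z * b ^+ 2.
    by rewrite /x /shell -/a -/b 2!mulrDr zK.
  by rewrite /h /sgn ler_norml; apply/andP; split; case: c; case: d; lra.
pose q t : R := 1 + al * t - (8^-1 + 2 * z) * t ^+ 2.
have low c d : x `^ al * q (h c d / x) <= shell K (step S c) (step T d) `^ al.
  have -> : shell K (step S c) (step T d) = x * (1 + h c d / x).
    by rewrite shell_step -/a -/b -/x /h; field; rewrite gt_eqF.
  have := hx c d; rewrite ler_norml => /andP[h1 _].
  rewrite powRM; [|exact: ltW|move: zz => /andP[_ ?]; lra].
  by apply: ler_wpM2l; [exact: powR_ge0|exact: powR_ge_quadratic].
move: (rr); rewrite ler_norml => /andP[r1 r2].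
have w1 : 0 <= 1 + r by lra.
have w2 : 0 <= 1 - r by lra.
pose mean := ((1 + r) * (q (h true true / x) + q (h false false / x))
  + (1 - r) * (q (h true false / x) + q (h false true / x))) / 4.
apply: (@le_trans _ _ (x `^ al * mean)); last first.
  rewrite /pair_mean /mean mulrA ler_pM2r ?invr_gt0 //.
  rewrite mulrDr !(mulrCA (x `^ al)).
  by rewrite lerD // ler_wpM2l // mulrDr lerD //; exact: low.
apply: ler_wpM2l; first exact: powR_ge0.
pose var := (4 * (a ^+ 2 + b ^+ 2 + 2 * (r * (a * b))) + 4) / x.
have -> : mean = 1 + (2 * al - (8^-1 + 2 * z) * var) / x.
  by rewrite /mean /var /q /h /sgn; field; rewrite gt_eqF.
rewrite lerD2l ler_pM2r ?invr_gt0 //.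
have v1 : var <= 4 * (1 + rho).
  rewrite /var ler_pdivrMr // /x /shell -/a -/b.
  have ab : 0 <= a * b by apply: mulr_ge0; exact: ltW.
  have c1 : r * (a * b) <= rho * (a * b) by apply: ler_wpM2r.
  have c2 : rho * (2 * (a * b)) <= rho * (a ^+ 2 + b ^+ 2).
    by apply: ler_wpM2l => //; have := sqr_ge0 (a - b); nra.
  have c3 : 0 <= rho * K by apply: mulr_ge0 => //; lra.
  lra.
have v2 : (8^-1 + 2 * z) * var <= (8^-1 + 2 * z) * (4 * (1 + rho)).
  by apply: ler_wpM2l => //; lra.
have v3 : z * rho <= z by nra.
rewrite /al; lra.
Qed.

End SlowFunction.

Section Growth.
Context {R : realType}.
Implicit Types (S T : state) (r rho d z x s : R).

(** An exponent below 1/2 gains a factor d beyond M, the solution of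
    M^(-z) = d. *)
Lemma powR_le_sqrt z d : 0 < z <= 2^-1 -> 0 < d ->
  exists C, forall x, 1 <= x -> x `^ (2^-1 - z) <= d * Num.sqrt x + C.
Proof.
move=> /andP[z0 z1] d0; pose M : R := d^-1 `^ z^-1.
have M0 : 0 <= M by exact: powR_ge0.
exists (Num.sqrt M) => x x1; have x0 : 0 < x by lra.
have [Mx|xM] := lerP M x.
  rewrite powRD; last by apply/implyP => _; rewrite gt_eqF.
  rewrite powR12_sqrt ?(ltW x0) // powRN mulrC.
  apply: ler_wpDr; first exact: sqrtr_ge0.
  apply: ler_wpM2r; first exact: sqrtr_ge0.
  rewrite invf_ple ?posrE ?powR_gt0 //.
  have -> : d^-1 = M `^ z.
    by rewrite /M -powRrM mulVf ?gt_eqF // powRr1 // invr_ge0 ltW.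
  by apply: ge0_ler_powR => //; rewrite ?nnegrE ltW.
apply: ler_wpDl; first by rewrite mulr_ge0 ?sqrtr_ge0 ?ltW.
apply: le_trans (ler_wsqrtr (ltW xM)).
by rewrite -powR12_sqrt ?(ltW x0) //; apply: ler_powR => //; lra.
Qed.

(** By [submartingale], the expected number of simultaneous central visits is
    then at most d E (k + l) + C, for d as small as desired. *)
Lemma slow_submartingale rho d : 0 <= rho < 1 -> 0 < d ->
  exists (g : state -> state -> R) (C : R),
  [/\ forall S T, 0 <= g S T,
      forall r S T, `|r| <= rho ->
        g S T + both_central S T <= pair_mean r g S T
    & forall S T, g S T <= d * (S.2%:R + T.2%:R) + C].
Proof.
move=> rho01 d0; have /andP[rho0 rho1] := rho01.
have z0 : 0 < slack rho by rewrite /slack; lra.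
have z1 : slack rho <= 80^-1 by rewrite /slack; lra.
have K1 : 1 <= offset rho.
  have zi : 1 <= (slack rho)^-1.
    by rewrite -[1]invrK lef_pV2 ?posrE ?invr1 //; lra.
  rewrite /offset; nra.
have xK S T : offset rho <= shell (offset rho) S T.
  by rewrite /shell -addrA lerDl addr_ge0 ?sqr_ge0.
have x0 S T : 0 < shell (offset rho) S T by have := xK S T; lra.
(* The gain at a simultaneous central visit, where the shell equals x1. *)
pose x1 : R := shell (offset rho) (0, 0%N) (0, 0%N).
pose c : R := x1 `^ (2^-1 - slack rho) * ((1 - rho) / 4 / x1).
have c0 : 0 < c.
  apply: mulr_gt0; first by apply: powR_gt0; exact: x0.
  by apply: divr_gt0; [lra|exact: x0].
have [||C HC] := @powR_le_sqrt (slack rho) (c * d).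
- by rewrite z0; lra.
- exact: mulr_gt0.
exists (fun S T => c^-1 * slow_fun rho S T).
exists (c^-1 * (c * d * (Num.sqrt (offset rho) + 1) + C)); split.
- by move=> S T; rewrite mulr_ge0 ?powR_ge0 // invr_ge0 ltW.
- move=> r S T rr; have := slow_fun_drift S T rho01 rr.
  have -> : pair_mean r (fun S T => c^-1 * slow_fun rho S T) S T =
      c^-1 * pair_mean r (slow_fun rho) S T by rewrite /pair_mean; ring.
  move=> H; apply: le_trans (ler_wpM2l _ H); last by rewrite invr_ge0 ltW.
  rewrite mulrDr mulr1 mulrDr lerD2l /both_central.
  case: andP => [[/eqP S0 /eqP T0]|_] /=; last first.
    rewrite mulr_ge0 ?invr_ge0 ?ltW // mulr_gt0 ?powR_gt0 //.
    by rewrite divr_gt0 //; lra.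
  have -> : slow_fun rho S T * ((1 - rho) / 4 / shell (offset rho) S T) = c.
    by rewrite /slow_fun /c /x1 /shell /radius S0 T0.
  by rewrite mulVf // gt_eqF.
- move=> S T; have [k0 l0] := (ler0n R S.2, ler0n R T.2).
  rewrite [leRHS](_ : _ = c^-1 *
    (c * d * (S.2%:R + T.2%:R + Num.sqrt (offset rho) + 1) + C)); last first.
    by field; rewrite gt_eqF.
  apply: ler_wpM2l; first by rewrite invr_ge0 ltW.
  apply: le_trans (HC _ _) _; first exact: le_trans (xK S T).
  rewrite lerD2r; apply: ler_wpM2l; first by rewrite mulr_ge0 // ltW.
  have q0 := sqrtr_ge0 (offset rho).
  set y := _ + 1; have y0 : 0 <= y by rewrite /y; lra.
  rewrite -[y]ger0_norm // -sqrtr_sqr; apply: ler_wsqrtr.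
  have q2 : Num.sqrt (offset rho) ^+ 2 = offset rho.
    by rewrite sqr_sqrtr //; lra.
  rewrite /shell /radius /y -[X in X + _ + _]q2.
  move: q0 k0 l0; move: (Num.sqrt _) (S.2%:R) (T.2%:R) => q k l q0 k0 l0.
  have := mulr_ge0 q0 k0; have := mulr_ge0 q0 l0; have := mulr_ge0 k0 l0; nra.
Qed.

(** * Growth of the distance *)

(** Adding three times the function of [slow_submartingale] compensates the
    possible drop of the potential; at d = 1/42 this consumes half of the
    term (k + l) / 7. *)
Lemma expect_tree_dist_ge rho : 0 <= rho < 1 -> exists C, forall n
    (mu : cube n * cube n -> R), admissible mu -> rho_max mu <= rho ->
  expect mu (fun w => (walk w.1).2%:R + (walk w.2).2%:R) / 14 - C <=
  expect mu (fun w => tree_dist (walk w.1) (walk w.2)).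
Proof.
move=> rho01.
have [|g [C [g0 gD gU]]] := @slow_submartingale rho 42^-1 rho01; first by lra.
exists (3 * C + 1) => n mu adm rmu.
pose V S T := potential S T + 3 * g S T.
have drift (m : nat) r S T : `|r| <= rho -> V S T <= pair_mean r V S T.
  move=> rr; rewrite /V.
  have -> : pair_mean r (fun S T => potential S T + 3 * g S T) S T =
      pair_mean r potential S T + 3 * pair_mean r g S T.
    by rewrite /pair_mean; ring.
  have r1 : `|r| <= 1 by case/andP: rho01 => _ /ltW; exact: le_trans.
  by have := potential_drift S T r1; have := gD r S T rr; lra.
have H := submartingale (F := fun=> V) adm rmu drift.
have low : 0 <= V (walk [::]) (walk [::]).
  rewrite /V addr_ge0 ?mulr_ge0 // /potential /tree_dist /bonus /walk /=.
  by rewrite subrr normr0; lra.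
have {H low} := le_trans low H.
have bonus1 S T : bonus S T <= 3 / 7 :> R.
  case: S T => [j [|k]] [j' l]; rewrite /bonus /=; last by lra.
  by elim/ord3_ind: j; elim/ord3_ind: j' => /=; lra.
pose d (w : cube n * cube n) : R := tree_dist (walk w.1) (walk w.2).
pose h (w : cube n * cube n) : R := (walk w.1).2%:R + (walk w.2).2%:R.
have le (w : cube n * cube n) : V (walk w.1) (walk w.2) <=
    d w + ((- 14^-1) * h w + (3 * C + 1)).
  rewrite /d /h.
  have := bonus1 (walk w.1) (walk w.2); have := bonus1 (walk w.2) (walk w.1).
  have := gU (walk w.1) (walk w.2); rewrite /V /potential.
  move: (walk w.1) (walk w.2) => S T; move: (g S T) => x.
  move: (bonus S T) (bonus T S) => y y0.
  by move: (S.2%:R) (T.2%:R) => k l; lra.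
move=> H; have := le_trans H (expect_le adm.1 le).
rewrite (expectD mu d) (expectD mu (fun w => _ * h w)) expectZ expect_cst;
  last exact: adm.1.
rewrite -/d -/h; move: (expect mu d) (expect mu h) => x y; lra.
Qed.

(** A minorant of a by even powers, so that the first moment of the radius
    can be bounded below through its second and fourth moments. *)
Lemma ge_quartic (a s : R) : 0 <= a -> 0 < s ->
  a ^+ 2 / (2 * s) - a ^+ 4 / (32 * s ^+ 3) <= a.
Proof.
move=> a0 s0; pose u := a / (2 * s).
have u0 : 0 <= u by rewrite divr_ge0 // mulr_ge0 // ltW.
have -> : a = 2 * s * u by rewrite /u; field; rewrite gt_eqF.
rewrite -subr_ge0.
(* u^3 - 4 u + 4 > 0 for u >= 0: near its minimum 2 / sqrt 3, approximated by
   6/5, it is compared with a cubic that has a double root. *)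
have -> : 2 * s * u -
    ((2 * s * u) ^+ 2 / (2 * s) - (2 * s * u) ^+ 4 / (32 * s ^+ 3))
   = s * u / 2 * ((u + 12 / 5) * (u - 6 / 5) ^+ 2 + (8 / 25 * u + 68 / 125)).
  by field; rewrite gt_eqF.
apply: mulr_ge0; first by rewrite divr_ge0 // mulr_ge0 // ltW.
by apply: addr_ge0; [apply: mulr_ge0; [lra|exact: sqr_ge0]|lra].
Qed.

(** [ge_quartic] at s = sqrt n, where both terms of the minorant are of order
    sqrt n. *)
Lemma expect_radius_ge n (mu : cube n * cube n -> R) : (0 < n)%N ->
  admissible mu ->
  13 / 16 * Num.sqrt n%:R <=
  expect mu (fun w => radius (walk w.1) + radius (walk w.2)).
Proof.
move=> n0 adm; set s := Num.sqrt _.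
have s1 : 1 <= s by rewrite -[1]sqrtr1 ler_wsqrtr // ler1n.
have s0 : 0 < s by lra.
have s2 : s ^+ 2 = n%:R by rewrite sqr_sqrtr.
(* For the radius a, both a^2 - m and a^4 - 6 m a^2 + 3 m^2 + 2 m are
   martingales; the coefficients are such that at m = n their combination is
   a^2 / (2 s) - a^4 / (32 s^3) up to a constant. *)
pose e := 10 / (32 * s); pose c := (32 * s ^+ 3)^-1.
pose F (m : nat) S : R := e * (radius S ^+ 2 - m%:R) -
  c * ((radius S ^+ 2) ^+ 2 - 6 * m%:R * radius S ^+ 2
       + 3 * m%:R ^+ 2 + 2 * m%:R).
pose F2 m S T := F m S + F m T.
have drift m r S T :
    `|r| <= rho_max mu -> F2 m S T <= pair_mean r (F2 m.+1) S T.
  move=> _; rewrite /F2 le_eqVlt; apply/orP; left; apply/eqP.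
  rewrite /pair_mean /F !radius_step /sgn -(natr1 m).
  move: (e) (c) (radius S) (radius T) (m%:R) => x y a b k.
  by field.
have := submartingale adm (lexx _) drift.
have low : 0 <= F2 0%N (walk [::]) (walk [::]).
  rewrite /F2; have -> : F 0%N (walk [::]) + F 0%N (walk [::]) =
     (80 * s ^+ 2 - 2) / (512 * s ^+ 3).
    by rewrite /F /walk /radius /e /c /=; field; rewrite gt_eqF.
  have ss : 1 <= s ^+ 2 by rewrite s2 ler1n.
  apply: divr_ge0; first by lra.
  by apply: mulr_ge0; [exact: ler0n|apply/exprn_ge0/ltW].
move=> /(le_trans low) {low} H.
have le (w : cube n * cube n) : F2 n (walk w.1) (walk w.2) <=
    radius (walk w.1) + radius (walk w.2) + - (13 / 16 * s).
  have Fn S : F n S <= radius S - 13 / 32 * s.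
    have a0 : 0 <= radius S :> R by rewrite /radius addr_ge0.
    have := ge_quartic a0 s0; rewrite /F /e /c -s2.
    set a := radius S => h.
    have -> : 10 / (32 * s) * (a ^+ 2 - s ^+ 2) -
        (32 * s ^+ 3)^-1 * ((a ^+ 2) ^+ 2 - 6 * s ^+ 2 * a ^+ 2
                            + 3 * (s ^+ 2) ^+ 2 + 2 * s ^+ 2) =
      a ^+ 2 / (2 * s) - a ^+ 4 / (32 * s ^+ 3) - 13 / 32 * s - (16 * s)^-1.
      by field; rewrite gt_eqF.
    have : 0 <= (16 * s)^-1 by rewrite invr_ge0 mulr_ge0 // ltW.
    lra.
  by rewrite /F2; have := Fn (walk w.1); have := Fn (walk w.2); lra.
have := le_trans H (expect_le adm.1 le).
rewrite expectD expect_cst; last exact: adm.1.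
by move: (expect mu _) => x; lra.
Qed.

End Growth.

(** * The walk in the plane *)

Section Geometry.
Context {R : realType}.
Implicit Types (S T : state) (z : R[i]).

Definition point S : R[i] := spider_point S.1 S.2.

Lemma spider_stepE S b : spider_step (point S) b = point (step S b).
Proof.
case: S => j k; rewrite /point; case: b; first by rewrite spider_step_up.
by rewrite spider_step_down; case: k.
Qed.

Lemma spiderE n (t : cube n) : spider t = point (walk t).
Proof.
rewrite /spider /walk.
have -> : 0 = point (0, 0%N) by rewrite /point /spider_point mul0r addr0.
by elim: (tval t) (0, 0%N) => //= b s IH S; rewrite spider_stepE IH.
Qed.

Definition sqnorm z : R := complex.Re z ^+ 2 + complex.Im z ^+ 2.

Lemma sqnorm_point S :
  sqnorm (point S) =
  [:: S.2%:R ^+ 2; S.2%:R ^+ 2 + S.2%:R + 1; (S.2%:R + 1) ^+ 2]`_(S.1).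
Proof.
case: S => j k; rewrite /sqnorm /point spider_pointE.
have := @sin2_2pi3 R; move: (sin _) => s s2.
elim/ord3_ind: j => /=; first by rewrite expr0n addr0.
- by rewrite [X in _ + X]exprMn s2; field.
- by rewrite [X in _ + X]exprMn s2; field.
Qed.

Lemma sqnorm_point_step S :
  sqnorm (point (step S true)) + sqnorm (point (step S false)) =
  2 * sqnorm (point S) + 2.
Proof.
rewrite !sqnorm_point; case: S => j k; rewrite /step /=.
by elim/ord3_ind: j; case: k => [|k] /=;
  rewrite -?(natr1 k.+1) -?(natr1 k); ring.
Qed.

(** Two rays meet at an angle of 120 degrees, and
    p^2 + p q + q^2 - (3/4) (p + q)^2 = (p - q)^2 / 4. *)
Lemma tree_dist_le_sqnorm S T :
  3 / 4 * tree_dist S T ^+ 2 <= sqnorm (point S - point T).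
Proof.
case: S T => [j k] [j' l]; rewrite /sqnorm /point !spider_pointE /tree_dist /=.
have := @sin2_2pi3 R; move: (sin _) => s s2.
rewrite (fun_if (fun x => x ^+ 2)) real_normK ?num_real //.
have k0 := ler0n R k; have l0 := ler0n R l.
have h1 := sqr_ge0 (k%:R - l%:R : R); have h2 := sqr_ge0 (k%:R - l%:R - 1 : R).
have h3 := sqr_ge0 (k%:R - l%:R + 1 : R).
elim/ord3_ind: j; elim/ord3_ind: j' => /=;
  rewrite ?sub0r ?subr0 -?mulNr -?mulrDl ?exprMn ?s2; nra.
Qed.

(** The process |Z_m|^2 - m is a martingale under the coupling as well. *)
Lemma expect_sqnorm_le n (mu : cube n * cube n -> R) : admissible mu ->
  expect mu (fun w => sqnorm (point (walk w.1)) + sqnorm (point (walk w.2)))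
  <= 2 * n%:R.
Proof.
move=> adm.
pose F (m : nat) S T : R :=
  2 * m%:R + (- 1) * (sqnorm (point S) + sqnorm (point T)).
have drift m r S T : `|r| <= rho_max mu -> F m S T <= pair_mean r (F m.+1) S T.
  move=> _; rewrite le_eqVlt; apply/orP; left; apply/eqP.
  rewrite /pair_mean /F -(natr1 m).
  have := sqnorm_point_step S; have := sqnorm_point_step T.
  move: (sqnorm (point (step S true))) (sqnorm (point (step S false))) => a b.
  move: (sqnorm (point (step T true))) (sqnorm (point (step T false))) => c d.
  by move=> /(canRL (addrK _)) -> /(canRL (addrK _)) ->; field.
have := submartingale adm (lexx _) drift.
have -> : F 0%N (walk [::]) (walk [::]) = 0.
  by rewrite /F !sqnorm_point /=; ring.
rewrite (expectD mu (fun=> 2 * n%:R)) expect_cst ?expectZ; last exact: adm.1.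
by move: (expect mu _) => x; lra.
Qed.

(** Polarization: 2 Re (conj Z' Z'') = |Z'|^2 + |Z''|^2 - |Z' - Z''|^2. *)
Lemma gap_ge n (mu : cube n * cube n -> R) : (0 < n)%N -> admissible mu ->
  3 / 8 * expect mu (fun w => tree_dist (walk w.1) (walk w.2) ^+ 2) / n%:R <=
  l2norm (spider_seq R n) ^+ 2 -
    complex.Re (coupled_form (spider_seq R n) mu (spider_seq R n)).
Proof.
move=> n0 adm; rewrite l2norm_spider_scaled // expr1n.
have n0' : 0 < n%:R :> R by rewrite ltr0n.
pose p (w : cube n * cube n) : R := complex.Re
  (conjc (point (walk w.1)) * point (walk w.2)).
have -> : complex.Re (coupled_form (spider_seq R n) mu (spider_seq R n)) =
    expect mu p / n%:R.
  rewrite /coupled_form (big_morph (@complex.Re R) (id1 := 0) (op1 := +%R)) //;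
    last by case=> ? ? [].
  rewrite /expect mulr_suml; apply: eq_bigr => w _.
  rewrite /= /spider_scaled !spiderE /p -fmorphV /=.
  have sn : (Num.sqrt n%:R)^-1 * (Num.sqrt n%:R)^-1 = n%:R^-1 :> R.
    by rewrite -invfM -expr2 sqr_sqrtr.
  case: (point _) => a b; case: (point _) => c d /=; rewrite -sn; ring.
pose q (w : cube n * cube n) : R :=
  sqnorm (point (walk w.1)) + sqnorm (point (walk w.2)).
have E2 : expect mu q <= 2 * n%:R by exact: expect_sqnorm_le.
have le (w : cube n * cube n) :
    3 / 4 * tree_dist (walk w.1) (walk w.2) ^+ 2 <= q w + (- 2) * p w.
  apply: le_trans (tree_dist_le_sqnorm _ _) _; rewrite /q /p /sqnorm.
  by case: (point _) => a b; case: (point _) => c d /=; nra.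
have := expect_le adm.1 le; rewrite expectD !expectZ.
rewrite ler_pdivrMr // mulrBl divfK ?gt_eqF // mul1r.
move: (expect mu (fun w => tree_dist _ _ ^+ 2)) (expect mu q) (expect mu p) E2.
by move=> x y z; lra.
Qed.

(** The bound is free of rho: only the rank beyond which it holds depends on
    it. *)
Lemma gap_unif (rho : R) : 0 <= rho < 1 -> exists N, forall n
    (mu : cube n * cube n -> R), (N <= n)%N ->
    admissible mu -> rho_max mu <= rho ->
  2000^-1 <= l2norm (spider_seq R n) ^+ 2 -
    complex.Re (coupled_form (spider_seq R n) mu (spider_seq R n)).
Proof.
move=> rho01; have [C HC] := expect_tree_dist_ge rho01.
have [N HN] : exists N : nat, (100 * (C + 1)) ^+ 2 <= N%:R.
  by exists (Num.bound ((100 * (C + 1)) ^+ 2)); apply/ltW/archi_boundP/sqr_ge0.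
exists (maxn 1 N) => n mu; rewrite geq_max => /andP[n0 Nn] adm rmu.
apply: le_trans (gap_ge n0 adm).
have n0' : 0 < n%:R :> R by rewrite ltr0n.
have H1 := HC n mu adm rmu; have H2 := expect_radius_ge n0 adm.
set s := Num.sqrt _ in H2.
have s0 : 0 < s by rewrite sqrtr_gt0.
have s2 : s ^+ 2 = n%:R by rewrite sqr_sqrtr // ltW.
have sC : 100 * (C + 1) <= s.
  apply: le_trans (ler_norm _) _; rewrite -sqrtr_sqr; apply: ler_wsqrtr.
  by apply: le_trans HN _; rewrite ler_nat.
pose h (w : cube n * cube n) : R := (walk w.1).2%:R + (walk w.2).2%:R.
pose d (w : cube n * cube n) : R := tree_dist (walk w.1) (walk w.2).
have rE (w : cube n * cube n) :
    radius (walk w.1) + radius (walk w.2) = h w + 1 :> R.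
  by rewrite /radius /h; field.
(* The tangent line of the square at s / 20 replaces Jensen's inequality. *)
have le (w : cube n * cube n) : s / 10 * d w + - (s ^+ 2 / 400) <= d w ^+ 2.
  have := sqr_ge0 (d w - s / 20); nra.
have := expect_le adm.1 le.
rewrite (expectD mu (fun w => _ * d w)) expectZ expect_cst; last exact: adm.1.
move: H1 H2; rewrite -/d -/h.
have -> : expect mu (fun w => radius (walk w.1) + radius (walk w.2)) =
    expect mu h + 1.
  by rewrite -(expect_cst 1 adm.1) -expectD; apply: eq_bigr => w _; rewrite rE.
rewrite ler_pdivlMr // -s2.
move: (expect mu d) (expect mu h) (expect mu (fun w => d w ^+ 2)) => x y v.
move=> H1 H2 H3.
have H4 : s / 20 - (C + 1) <= x by lra.
have H5 : s / 25 <= x by lra.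
have H6 : s * (s / 25) <= s * x by apply: ler_wpM2l => //; exact: ltW.
nra.
Qed.
End Geometry.

Lemma limn_esup_lt (R : realType) (u : nat -> \bar R) (l : \bar R) :
  (limn_esup u < l)%E ->
  exists2 y, (y < l)%E & exists N, forall n, (N <= n)%N -> (u n <= y)%E.
Proof.
move=> /ereal_inf_lt [_ [V [N _ NV] <-] Vl].
exists (ereal_sup (u @` V)) => //; exists N => n Nn.
by apply: ereal_sup_ubound; exists n => //; apply: NV.
Qed.

Theorem theorem4p1 (R : realType) : ~ cosy (spider_seq R).
Proof.
have eps0 : 0 < 2000^-1 :> R by rewrite invr_gt0 ltr0n.
move=> /(_ _ eps0) [mu [adm /limn_esup_lt[y y1 [N1 rho_le]]]].
move=> /limn_esup_lt[e e1 [N2 gap_le]].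
(* The case y = -oo is excluded because rho_max is nonnegative. *)
have y0 : (0 <= y)%E.
  apply: le_trans (rho_le N1 (leqnn _)); rewrite lee_fin /rho_max.
  exact: bigmax_ge_id.
have [rho yE] : exists rho : R, y = rho%:E.
  by case: y y1 y0 {rho_le} => // rho _ _; exists rho.
have rho01 : 0 <= rho < 1 by move: y0 y1; rewrite yE lee_fin lte_fin => -> ->.
have [N0 gap] := gap_unif rho01.
pose n := maxn (maxn N0 N1) (maxn N2 1).
have rmu : rho_max (mu n) <= rho.
  by rewrite -lee_fin -yE; apply: rho_le; rewrite /n !leq_max leqnn !orbT.
have n0 : (0 < n)%N by rewrite /n !leq_max !orbT.
have low := gap n (mu n) _ (adm n n0) rmu.
have := gap_le n; rewrite {1}/n !leq_max leqnn !orbT => /(_ isT) up.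
have := le_lt_trans up e1; rewrite lte_fin ltNge low //.
by rewrite /n !leq_max leqnn.
Qed.
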